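(* Let $\mathbf{k}$ be a field, $A=\mathbf{k}((t))$, let $k,\ell,r\geq 0$ be integers with $n=k+\ell+r$, and let $V=A^{\oplus n}$. Let $(M,N)\in\mathrm{RSD}(V)$ be a regular-singular decomposition whose corresponding RB-module is isomorphic to $A_0^{\oplus k}\oplus A_1^{\oplus\ell}\oplus A_r^{\oplus r}$. Then the stabilizer of $(M,N)$ in $GL_n(A)$ is $$\mathrm{Stab}_{GL_n(A)}(M,N)\cong GL_k(A)\times GL_\ell(A)\times GL_r(\mathbf{k}),$$ and the $GL_n(A)$-orbit $\mathcal{O}_{k,\ell,r}$ of $(M,N)$ is $$\mathcal{O}_{k,\ell,r}\cong GL_n(A)/\bigl(GL_k(A)\times GL_\ell(A)\times GL_r(\mathbf{k})\bigr).$$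
   Context: Let $\mathcal{O}=\mathbf{k}[[t]]$, so $A=\mathcal{O}\oplus t^{-1}\mathbf{k}[t^{-1}]$, and let $P:A\to A$ be the $\mathbf{k}$-linear projection onto $\mathcal{O}$ with kernel $t^{-1}\mathbf{k}[t^{-1}]$. An RB-module over $(A,P)$ is a pair $(V,p)$ with $V$ an $A$-module and $p:V\to V$ $\mathbf{k}$-linear with $P(a)p(x)=p(P(a)x+ap(x)-ax)$ for all $a\in A,x\in V$; isomorphisms are $A$-linear bijections commuting with the operators. $A_0=(A,0)$, $A_1=(A,\mathrm{Id})$, $A_r=(A,P)$ (here the subscript $r$ is just a symbol). A regular-singular decomposition (RSD) of $V$ is a pair $(M,N)$ of $\mathbf{k}$-subspaces with $V=M\oplus N$, $M$ an $\mathcal{O}$-submodule and $N$ a $\mathbf{k}[t^{-1}]$-submodule of $V$. The RB-module corresponding to $(M,N)$ is $(V,p)$ with $p$ the projection of $V$ onto $M$ with kernel $N$. $GL_n(A)$ acts on $\mathrm{RSD}(V)$, the set of all RSDs of $V$, by $\phi(M,N)=(\phi(M),\phi(N))$. *)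

(* Defs.v *)
From HB Require Import structures.
From mathcomp Require Import all_boot all_order all_algebra.
From mathcomp Require Import zify ring.
From mathcomp Require Import boolp classical_sets functions fsbigop.

Set Implicit Arguments.
Unset Strict Implicit.
Unset Printing Implicit Defensive.

Import Order.TTheory GRing.Theory Num.Theory.
Local Open Scope classical_set_scope.
Local Open Scope ring_scope.

(* A Laurent series is its family of coefficients: [coef f i] is the
   coefficient of t^i, and the coefficients vanish below some index. *)
Definition vanish_below (K : fieldType) (a : int) (f : int -> K) : Prop :=
  forall i, i < a -> f i = 0.

Record laurent (K : fieldType) := Laurent {
  coef :> int -> K ;
  coef_vanish : exists a, vanish_below a coef }.

HB.instance Definition _ (K : fieldType) := gen_eqMixin (laurent K).
HB.instance Definition _ (K : fieldType) := gen_choiceMixin (laurent K).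

Section LaurentZmodule.
Variable K : fieldType.
Implicit Types (f g h : laurent K) (a b : int).

Lemma laurentP f g : (forall i, f i = g i) -> f = g.
Proof.
case: f g => [f fP] [g gP] /= /funext fg; rewrite -{}fg in gP *.
by congr Laurent; exact: Prop_irrelevance.
Qed.

Lemma vanish_belowW a b (f : int -> K) :
  a <= b -> vanish_below b f -> vanish_below a f.
Proof. by move=> ab fb i ia; apply: fb; lia. Qed.

Lemma vanish_below2 f g :
  exists a, vanish_below a f /\ vanish_below a g.
Proof.
have [a fa] := coef_vanish f; have [b gb] := coef_vanish g.
by exists (Order.min a b); split; [apply: vanish_belowW fa|apply: vanish_belowW gb];
  lia.
Qed.

Fact laurent0_subproof : exists a, vanish_below a (fun=> 0 : K).
Proof. by exists 0. Qed.
Definition laurent0 := Laurent laurent0_subproof.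

Fact laurentN_subproof f : exists a, vanish_below a (fun i => - f i).
Proof. by have [a fa] := coef_vanish f; exists a => i /fa ->; rewrite oppr0. Qed.
Definition laurentN f := Laurent (laurentN_subproof f).

Fact laurentD_subproof f g : exists a, vanish_below a (fun i => f i + g i).
Proof.
have [a [fa ga]] := vanish_below2 f g.
by exists a => i ia; rewrite fa ?ga ?addr0.
Qed.
Definition laurentD f g := Laurent (laurentD_subproof f g).

Fact laurentZ_subproof (c : K) f : exists a, vanish_below a (fun i => c * f i).
Proof. by have [a fa] := coef_vanish f; exists a => i /fa ->; rewrite mulr0. Qed.
Definition laurentZ c f := Laurent (laurentZ_subproof c f).

Fact laurentDA : associative laurentD.
Proof. by move=> f g h; apply: laurentP => i /=; rewrite addrA. Qed.
Fact laurentDC : commutative laurentD.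
Proof. by move=> f g; apply: laurentP => i /=; rewrite addrC. Qed.
Fact laurent0D : left_id laurent0 laurentD.
Proof. by move=> f; apply: laurentP => i /=; rewrite add0r. Qed.
Fact laurentND : left_inverse laurent0 laurentN laurentD.
Proof. by move=> f; apply: laurentP => i /=; rewrite addNr. Qed.

HB.instance Definition _ := GRing.isZmodule.Build (laurent K)
  laurentDA laurentDC laurent0D laurentND.

Lemma lcoef0 i : (0 : laurent K) i = 0. Proof. by []. Qed.
Lemma lcoefD f g i : (f + g) i = f i + g i. Proof. by []. Qed.
Lemma lcoefN f i : (- f) i = - f i. Proof. by []. Qed.

End LaurentZmodule.

Section Conv.
Variable K : fieldType.
Implicit Types F G H : nat -> K.

Definition seqconv F G n : K := \sum_(j < n.+1) F j * G (n - j)%N.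

Lemma conv_poly N F G n : (n < N)%N ->
  seqconv F G n = ((\poly_(i < N) F i) * (\poly_(i < N) G i))`_n.
Proof.
move=> nN; rewrite coefM; apply: eq_bigr => j _; rewrite !coef_poly.
by have := ltn_ord j; rewrite ltnS => jn; rewrite !ifT //; lia.
Qed.

Lemma eq_conv F F' G G' n : (forall j, F j = F' j) -> (forall j, G j = G' j) ->
  seqconv F G n = seqconv F' G' n.
Proof. by move=> FF' GG'; apply: eq_bigr => j _; rewrite FF' GG'. Qed.

Lemma convC F G n : seqconv F G n = seqconv G F n.
Proof. by rewrite !(@conv_poly n.+1) // mulrC. Qed.

Lemma convA F G H n : seqconv F (seqconv G H) n = seqconv (seqconv F G) H n.
Proof.
pose p F := \poly_(i < n.+1) F i.
have pE F' G' j : (j <= n)%N -> (p (seqconv F' G'))`_j = (p F' * p G')`_j.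
  by move=> jn; rewrite coef_poly ltnS jn (@conv_poly n.+1).
transitivity ((p F * (p G * p H))`_n).
  rewrite (@conv_poly n.+1) // !coefM; apply: eq_bigr => j _.
  by rewrite pE // leq_subr.
rewrite mulrA (@conv_poly n.+1) // !coefM; apply: eq_bigr => j _.
by rewrite pE // -ltnS ltn_ord.
Qed.

Lemma convDl F F' G n :
  seqconv (fun j => F j + F' j) G n = seqconv F G n + seqconv F' G n.
Proof. by rewrite -big_split; apply: eq_bigr => j _; rewrite mulrDl. Qed.

Lemma conv1l G n : seqconv (fun j => (j == 0)%:R) G n = G n.
Proof.
rewrite /seqconv big_ord_recl /= mul1r subn0 big1 ?addr0 // => j _.
by rewrite mul0r.
Qed.

Fixpoint conv_inv_seq F n : seq K :=
  if n is n'.+1 then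
    let s := conv_inv_seq F n' in
    rcons s ((F 0)^-1 * ((n' == 0)%:R - \sum_(j < n') F j.+1 * s`_(n' - j.+1)))
  else [::].

Lemma conv_inv F : F 0 != 0 -> exists G, forall n, seqconv F G n = (n == 0)%:R.
Proof.
move=> F0; pose s := conv_inv_seq F; exists (fun n => (s n.+1)`_n).
have size_s n : size (s n) = n by elim: n => //= n IH; rewrite size_rcons IH.
have sE m n : (n < m)%N -> (s m)`_n = (s n.+1)`_n.
  elim: m => // m IH; rewrite ltnS leq_eqVlt => /predU1P[-> //|nm].
  by rewrite {1}/s /= nth_rcons -/(s m) size_s nm IH.
move=> n; rewrite /seqconv big_ord_recl subn0 {1}/s /= nth_rcons -/(s n) size_s.
rewrite ltnn eqxx mulrA divff // mul1r -addrA [X in _ + X]addrC.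
rewrite [X in _ + X](_ : _ = 0) ?addr0 //.
apply/eqP; rewrite subr_eq0; apply/eqP; apply: eq_bigr => j _.
rewrite /bump /= add1n; congr (_ * _). 
by rewrite [RHS]sE //; have := ltn_ord j; lia.
Qed.

End Conv.

Section LaurentRing.
Variable K : fieldType.
Implicit Types (f g h : laurent K) (a b : int).

(* The sum over all integers has finite support. *)
Definition laurentM_coef (f g : int -> K) (n : int) : K :=
  \sum_(i \in [set: int]) f i * g (n - i).

Definition coefs_from a (f : int -> K) (j : nat) : K := f (j%:Z + a).

Lemma laurentM_coefE a b (f g : int -> K) n (m : nat) :
    vanish_below a f -> vanish_below b g -> n - a - b < m%:Z ->
  laurentM_coef f g n = \sum_(j < m) f (j%:Z + a) * g (n - (j%:Z + a)).
Proof.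
move=> fa gb nm; rewrite /laurentM_coef.
rewrite (fsbigE [seq j%:Z + a | j <- iota 0 m]) //=.
- rewrite (eq_bigl xpredT) => [|i]; last by rewrite in_setT.
  by rewrite big_map -{1}[m]subn0 -/(index_iota 0 m) big_mkord.
- by rewrite map_inj_uniq ?iota_uniq // => i j; lia.
- move=> i _ /negP iP; have [/fa ->|ai] := ltP i a; first by rewrite mul0r.
  have [/gb ->|bi] := ltP (n - i) b; first by rewrite mulr0.
  case: iP; apply/mapP; exists `|i - a|%N; last by lia.
  by rewrite mem_iota /= add0n; lia.
Qed.

Lemma vanish_belowM a b (f g : int -> K) :
    vanish_below a f -> vanish_below b g ->
  vanish_below (a + b) (laurentM_coef f g).
Proof.
move=> fa gb n nab; rewrite (@laurentM_coefE a b _ _ _ 0) ?big_ord0 //.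
by lia.
Qed.

Lemma shiftM a b (f g : int -> K) n :
    vanish_below a f -> vanish_below b g ->
  coefs_from (a + b) (laurentM_coef f g) n = seqconv (coefs_from a f) (coefs_from b g) n.
Proof.
move=> fa gb; rewrite /coefs_from (@laurentM_coefE a b _ _ _ n.+1) //; last by lia.
apply: eq_bigr => j _; congr (_ * g _).
by have := ltn_ord j; lia.
Qed.

Lemma shift_ext a (f g : int -> K) : vanish_below a f -> vanish_below a g ->
  (forall n, coefs_from a f n = coefs_from a g n) -> forall i, f i = g i.
Proof.
move=> fa ga fg i; have [ia|ai] := ltP i a; first by rewrite fa ?ga.
by have := fg `|i - a|%N; rewrite /coefs_from (_ : _ + a = i) //; lia.
Qed.

Fact laurentM_subproof f g : exists a, vanish_below a (laurentM_coef f g).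
Proof.
have [a fa] := coef_vanish f; have [b gb] := coef_vanish g.
by exists (a + b); apply: vanish_belowM.
Qed.
Definition laurentM f g := Laurent (laurentM_subproof f g).

Fact laurent1_subproof : exists a, vanish_below a (fun i : int => (i == 0)%:R : K).
Proof. by exists 0 => i i0; rewrite (_ : (i == 0) = false) //; lia. Qed.
Definition laurent1 := Laurent laurent1_subproof.

Lemma vanish1 : vanish_below 0 laurent1.
Proof. by move=> i i0 /=; rewrite (_ : (i == 0) = false) //; lia. Qed.

Fact laurentMA : associative laurentM.
Proof.
move=> f g h; apply: laurentP.
have [a fa] := coef_vanish f; have [b gb] := coef_vanish g.
have [c hc] := coef_vanish h.
have gh := vanish_belowM gb hc; have fg := vanish_belowM fa gb.
apply: (@shift_ext (a + (b + c))) => [||n]; first exact: vanish_belowM.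
  by rewrite addrA; exact: vanish_belowM.
rewrite shiftM // addrA shiftM //.
rewrite (eq_conv n (fun=> erefl) (fun j => shiftM j gb hc)).
by rewrite [RHS](eq_conv n (fun j => shiftM j fa gb) (fun=> erefl)) convA.
Qed.

Fact laurentMC : commutative laurentM.
Proof.
move=> f g; apply: laurentP.
have [a fa] := coef_vanish f; have [b gb] := coef_vanish g.
apply: (@shift_ext (a + b)) => [||n]; first exact: vanish_belowM.
  by rewrite addrC; exact: vanish_belowM.
by rewrite shiftM // addrC shiftM // convC.
Qed.

Fact laurent1M : left_id laurent1 laurentM.
Proof.
move=> f; apply: laurentP; have [a fa] := coef_vanish f.
have := vanish_belowM vanish1 fa; rewrite add0r => fa'.
apply: (@shift_ext a) => // n.
rewrite -{1}[a]add0r shiftM //; last exact: vanish1.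
rewrite -[RHS]conv1l; apply: eq_conv => // j.
by rewrite /coefs_from /= addr0.
Qed.

Fact laurentMDl : left_distributive laurentM +%R.
Proof.
move=> f f' g; apply: laurentP.
have [a [fa f'a]] := vanish_below2 f f'; have [b gb] := coef_vanish g.
have ffa : vanish_below a (f + f') by move=> i ia; rewrite lcoefD fa ?f'a ?addr0.
have fgb := vanish_belowM fa gb; have f'gb := vanish_belowM f'a gb.
apply: (@shift_ext (a + b)) => [||n]; first exact: vanish_belowM.
  by move=> i ia /=; rewrite fgb ?f'gb ?addr0.
by rewrite shiftM // /coefs_from lcoefD [RHS]/= -/(coefs_from _ _ _) -/(coefs_from _ _ _)
  !shiftM // -convDl.
Qed.

Fact laurent1_neq0 : laurent1 != 0.
Proof.
by apply/eqP => /(congr1 (fun f : laurent K => f 0)) /= /eqP; rewrite oner_eq0.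
Qed.

HB.instance Definition _ := GRing.Zmodule_isComNzRing.Build (laurent K)
  laurentMA laurentMC laurent1M laurentMDl laurent1_neq0.

Lemma lcoef1 i : (1 : laurent K) i = (i == 0)%:R. Proof. by []. Qed.

Lemma lcoefM f g i : (f * g) i = \sum_(j \in [set: int]) f j * g (i - j).
Proof. by []. Qed.

Fact laurentZA (c d : K) f : laurentZ c (laurentZ d f) = laurentZ (c * d) f.
Proof. by apply: laurentP => i /=; rewrite mulrA. Qed.
Fact laurent1Z : left_id 1 (@laurentZ K).
Proof. by move=> f; apply: laurentP => i /=; rewrite mul1r. Qed.
Fact laurentZDr : right_distributive (@laurentZ K) +%R.
Proof. by move=> c f g; apply: laurentP => i /=; rewrite mulrDr. Qed.
Fact laurentZDl f : {morph (@laurentZ K)^~ f : c d / c + d}.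
Proof. by move=> c d; apply: laurentP => i /=; rewrite mulrDl. Qed.

HB.instance Definition _ := GRing.Zmodule_isLmodule.Build K (laurent K)
  laurentZA laurent1Z laurentZDr laurentZDl.

Lemma lcoefZ (c : K) f i : (c *: f) i = c * f i. Proof. by []. Qed.

Fact laurentZAl (c : K) f g : c *: (f * g) = (c *: f) * g.
Proof.
apply: laurentP.
have [a fa] := coef_vanish f; have [b gb] := coef_vanish g.
have cfa : vanish_below a (c *: f) by move=> i ia; rewrite lcoefZ fa ?mulr0.
have fgab := vanish_belowM fa gb.
apply: (@shift_ext (a + b)) => [||n].
- by move=> i iab /=; rewrite fgab ?mulr0.
- exact: vanish_belowM.
- rewrite [RHS]shiftM // {1}/coefs_from /= -/(coefs_from _ _ _) shiftM // /seqconv.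
  by rewrite mulr_sumr; apply: eq_bigr => j _; rewrite mulrA.
Qed.

HB.instance Definition _ :=
  GRing.Lmodule_isLalgebra.Build K (laurent K) laurentZAl.
HB.instance Definition _ := GRing.Lalgebra_isComAlgebra.Build K (laurent K).

Definition laurentV f : laurent K := xget 0 [set g | g * f = 1].

Fact laurentVM f : f != 0 -> laurentV f * f = 1.
Proof.
move=> f0; apply: (@xgetPex _ 0 [set g | g * f = 1]).
have [a fa] := coef_vanish f.
have exn : exists n, coefs_from a f n != 0.
  apply: contrapT => nex; move/eqP: f0; apply; apply: laurentP.
  apply: (shift_ext fa) => // n.
  by apply/eqP; apply/negPn/negP => fn; apply: nex; exists n.
pose v : int := (ex_minn exn)%:Z + a.
have fv : vanish_below v f.
  move=> i iv; have [/fa //|ai] := ltP i a.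
  have [n _ nmin] := ex_minnP exn; apply/eqP/negPn/negP => fi.
  move: iv; rewrite /v; have [m _ mmin] := ex_minnP exn => im.
  have /mmin : coefs_from a f `|i - a|%N != 0.
    by rewrite /coefs_from (_ : _ + a = i) //; lia.
  by lia.
have fv0 : coefs_from v f 0 != 0.
  by rewrite /coefs_from add0r /v; have [n] := ex_minnP exn.
have [G GP] := conv_inv fv0.
pose g (i : int) : K := if i < - v then 0 else G (absz (i + v)).
have gv : vanish_below (- v) g by move=> i; rewrite /g => ->.
have gP : exists b, vanish_below b g by exists (- v).
exists (Laurent gP); rewrite /= mulrC; apply: laurentP.
have := vanish_belowM fv gv; rewrite subrr => fgv.
apply: (@shift_ext 0) => //; first exact: vanish1.
move=> n; rewrite -[X in coefs_from X]/(0 : int) -{1}(subrr v) shiftM //.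
have GE j : coefs_from (- v) g j = G j.
  by rewrite /coefs_from /g ifF ?subrK //; lia.
rewrite (eq_conv n (fun=> erefl) GE) GP /coefs_from addr0.
by [].
Qed.

Fact laurentV0 : laurentV 0 = 0.
Proof.
by apply: xgetPN => g /= /eqP; rewrite mulr0 eq_sym oner_eq0.
Qed.

HB.instance Definition _ :=
  GRing.ComNzRing_isField.Build (laurent K) laurentVM laurentV0.

End LaurentRing.

Section RegularPart.
Variable K : fieldType.
Local Notation A := (laurent K).
Implicit Types a b : A.

(* k, as a subset of k((t)) *)
Definition constants : set A := range (fun c : K => c%:A).

(* k[[t]] *)
Definition power_series : set A := [set a | vanish_below 0 a].

(* k[t^-1]: a Laurent series without positive powers of t is a polynomial
   in t^-1. *)
Definition inv_poly : set A := [set a | forall i : int, 0 < i -> a i = 0].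

(* t^-1 k[t^-1] *)
Definition inv_poly_pos : set A := [set a | forall i : int, 0 <= i -> a i = 0].

Fact regpart_subproof a :
  exists n, vanish_below n (fun i : int => if 0 <= i then a i else 0).
Proof. by exists 0 => i i0; rewrite ifF //; lia. Qed.
Definition regpart a : A := Laurent (regpart_subproof a).

Lemma lcoef_regpart a i : regpart a i = if 0 <= i then a i else 0.
Proof. by []. Qed.

Lemma regpart_power_series a : power_series (regpart a).
Proof. by move=> i i0; rewrite lcoef_regpart ifF //; lia. Qed.

Lemma regpart_sing a : inv_poly_pos (a - regpart a).
Proof. by move=> i i0; rewrite lcoefD lcoefN lcoef_regpart i0 subrr. Qed.

Lemma regpart_id a : power_series a -> regpart a = a.
Proof.
move=> a0; apply: laurentP => i; rewrite lcoef_regpart.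
by case: leP => // /a0.
Qed.

Lemma regpart0 a : inv_poly_pos a -> regpart a = 0.
Proof.
by move=> a0; apply: laurentP => i; rewrite lcoef_regpart lcoef0; case: leP => // /a0.
Qed.

Fact regpart_is_linear : linear regpart.
Proof.
move=> c a b; apply: laurentP => i.
by rewrite !(lcoefD, lcoefZ, lcoef_regpart); case: ifP => // _; rewrite mulr0 addr0.
Qed.
HB.instance Definition _ :=
  GRing.isLinear.Build K A A *:%R regpart regpart_is_linear.

Lemma power_series_const (c : K) : power_series c%:A.
Proof.
by move=> i i0; rewrite lcoefZ lcoef1 (_ : (i == 0) = false) ?mulr0 //; lia.
Qed.

Lemma inv_poly_const (c : K) : inv_poly c%:A.
Proof.
by move=> i i0; rewrite lcoefZ lcoef1 (_ : (i == 0) = false) ?mulr0 //; lia.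
Qed.

Lemma inv_poly_posW a : inv_poly_pos a -> inv_poly a.
Proof. by move=> a0 i i0; apply: a0; lia. Qed.

Lemma power_seriesM a b : power_series a -> power_series b -> power_series (a * b).
Proof. by move=> a0 b0; rewrite /power_series /= -(addr0 0); apply: vanish_belowM. Qed.

Lemma inv_poly_posM a b : inv_poly_pos a -> inv_poly_pos b -> inv_poly_pos (a * b).
Proof.
move=> a0 b0 i i0; rewrite lcoefM fsbig1 // => j _.
have [/a0 ->|j0] := leP 0 j; first by rewrite mul0r.
by rewrite b0 ?mulr0 //; lia.
Qed.

End RegularPart.

Section Modules.
Variables (K : fieldType) (V : lmodType (laurent K)).
Local Notation A := (laurent K).

Definition submodule_over (S : set A) (M : set V) : Prop :=
  [/\ M 0, (forall x y, M x -> M y -> M (x + y))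
    & (forall a x, S a -> M x -> M (a *: x))].

Definition direct_sum (M N : set V) : Prop :=
  (forall v, exists x y, [/\ M x, N y & v = x + y]) /\ M `&` N = [set 0].

(* the projection onto M with kernel N, when V is the direct sum of M and N *)
Definition projection (M N : set V) (v : V) : V :=
  xget 0 [set x | M x /\ N (v - x)].

(* V is a K-module by restriction of scalars along [c |-> c%:A]. *)
Definition scalar_linear (p : V -> V) : Prop :=
  forall (c : K) (x y : V), p (c%:A *: x + y) = c%:A *: p x + p y.

Definition is_RSD (MN : set V * set V) : Prop :=
  [/\ submodule_over (@constants K) MN.1 /\ submodule_over (@constants K) MN.2,
      direct_sum MN.1 MN.2,
      submodule_over (@power_series K) MN.1
    & submodule_over (@inv_poly K) MN.2].

Definition rb_identity (p : V -> V) : Prop :=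
  forall (a : A) (x : V),
    regpart a *: p x = p (regpart a *: x + a *: p x - a *: x).

End Modules.

Record rb_module (K : fieldType) := RBModule {
  rb_carrier :> lmodType (laurent K) ;
  rb_op : rb_carrier -> rb_carrier ;
  rb_op_linear : scalar_linear rb_op ;
  rb_opP : rb_identity rb_op }.

Definition rb_iso (K : fieldType) (X Y : rb_module K) : Prop :=
  exists f : {linear X -> Y},
    bijective f /\ forall x, f (rb_op x) = rb_op (f x).

Section RankOne.
Variable K : fieldType.
Local Notation A := (laurent K).

Fact rb_zero_linear : scalar_linear (fun=> 0 : A^o).
Proof. by move=> c x y; rewrite scaler0 addr0. Qed.
Fact rb_zeroP : rb_identity (fun=> 0 : A^o).
Proof. by move=> a x; rewrite scaler0. Qed.

Fact rb_id_linear : scalar_linear (fun x : A^o => x).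
Proof. by []. Qed.
Fact rb_idP : rb_identity (fun x : A^o => x).
Proof. by move=> a x; rewrite addrK. Qed.

Fact rb_reg_linear : scalar_linear (@regpart K : A^o -> A^o).
Proof.
by move=> c x y; rewrite ![_%:A *: _]mulr_algl linearP.
Qed.
Fact rb_regP : rb_identity (@regpart K : A^o -> A^o).
Proof.
move=> a x; rewrite /GRing.scale /=.
have -> : regpart a * x + a * regpart x - a * x =
    regpart a * regpart x - (a - regpart a) * (x - regpart x) by ring.
have ax := power_seriesM (@regpart_power_series _ a) (@regpart_power_series _ x).
have ax' := inv_poly_posM (@regpart_sing _ a) (@regpart_sing _ x).
by rewrite linearB /= (regpart_id ax) (regpart0 ax') subr0.
Qed.

(* A_0, A_1 and A_r *)
Definition rb_zero := RBModule rb_zero_linear rb_zeroP.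
Definition rb_id := RBModule rb_id_linear rb_idP.
Definition rb_reg := RBModule rb_reg_linear rb_regP.

End RankOne.

Section DirectSums.
Variable K : fieldType.
Variables (X Y : rb_module K) (n : nat).

Definition rb_sum_op (z : X * Y) : X * Y := (rb_op z.1, rb_op z.2).
Fact rb_sum_linear : scalar_linear rb_sum_op.
Proof. by move=> c [x y] [x' y']; congr pair; apply: rb_op_linear. Qed.
Fact rb_sumP : rb_identity rb_sum_op.
Proof. by move=> a [x y]; congr pair; apply: rb_opP. Qed.
Definition rb_sum := RBModule rb_sum_linear rb_sumP.

Definition rb_pow_op (z : {ffun 'I_n -> X}) : {ffun 'I_n -> X} :=
  [ffun i => rb_op (z i)].
Fact rb_pow_linear : scalar_linear rb_pow_op.
Proof. by move=> c x y; apply/ffunP => i; rewrite !ffunE rb_op_linear. Qed.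
Fact rb_powP : rb_identity rb_pow_op.
Proof.
by move=> a x; apply/ffunP => i; rewrite !ffunE rb_opP; congr rb_op; rewrite !ffunE.
Qed.
Definition rb_pow := RBModule rb_pow_linear rb_powP.

End DirectSums.

Section RSDModule.
Variables (K : fieldType) (V : lmodType (laurent K)) (MN : set V * set V).
Hypothesis MN_RSD : is_RSD MN.
Local Notation p := (projection MN.1 MN.2).

Let submodN S (M : set V) x : submodule_over S M -> S (-1) -> M x -> M (- x).
Proof. by case=> _ _ SM S1 Mx; rewrite -scaleN1r; apply: SM. Qed.

Let power_seriesN1 : @power_series K (-1).
Proof. by rewrite -scaleN1r; apply: power_series_const. Qed.

Let inv_polyN1 : @inv_poly K (-1).
Proof. by rewrite -scaleN1r; apply: inv_poly_const. Qed.

Lemma projection_unique v x : MN.1 x -> MN.2 (v - x) -> p v = x.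
Proof.
case: MN_RSD => _ [_ I0] OM ON Mx Nx.
apply: xget_unique => // y [My Ny]; apply/eqP; rewrite -subr_eq0; apply/eqP.
suff : (MN.1 `&` MN.2) (y - x) by rewrite I0.
split; first by case: (OM) => _ D _; apply: D => //; exact: (submodN OM).
have -> : y - x = (v - x) - (v - y) by rewrite opprB [RHS]addrC subrKA.
by case: (ON) => _ D _; apply: D => //; exact: (submodN ON).
Qed.

Lemma projectionP v : MN.1 (p v) /\ MN.2 (v - p v).
Proof.
apply: (@xgetPex _ 0 [set x | MN.1 x /\ MN.2 (v - x)]).
case: MN_RSD => _ [+ _] _ _ => /(_ v) [x [y [Mx Ny ->]]].
by exists x; split=> //; rewrite addrC addKr.
Qed.

Fact projection_linear : scalar_linear p.
Proof.
case: MN_RSD => _ _ [_ MD MZ] [_ ND NZ] c x y.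
have [Mx Nx] := projectionP x; have [My Ny] := projectionP y.
apply: projection_unique; first by apply/MD/My/MZ/Mx/power_series_const.
by rewrite opprD addrACA -scalerBr; apply/ND/Ny/NZ/Nx/inv_poly_const.
Qed.

Fact projection_rb : rb_identity p.
Proof.
case: (MN_RSD) => _ _ OM ON a x; have [Mx Nx] := projectionP x.
case: (OM) (ON) => _ MD MZ [_ ND NZ].
apply/esym/projection_unique; first by apply/MZ/Mx/regpart_power_series.
have -> : regpart a *: x + a *: p x - a *: x - regpart a *: p x =
    - ((a - regpart a) *: (x - p x)).
  by rewrite scalerBl !scalerBr !opprB -[X in X - _]addrA addrAC.
apply: (submodN ON) => //; apply: NZ => //.
exact/inv_poly_posW/regpart_sing.
Qed.

Definition rsd_module := RBModule projection_linear projection_rb.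

End RSDModule.

(* The library's 'GL_n[R] requires R to be finite and n > 0. *)
Record GL (R : comUnitRingType) (n : nat) := MkGL {
  GLmx :> 'M[R]_n ;
  GL_unit : GLmx \in unitmx }.

HB.instance Definition _ (R : comUnitRingType) n :=
  [isSub for @GLmx R n].
HB.instance Definition _ (R : comUnitRingType) n := [Choice of GL R n by <:].

Section GLGroup.
Variables (R : comUnitRingType) (n : nat).
Implicit Types g h : GL R n.

Definition GL_one : GL R n := MkGL (unitmx1 R n).
Fact GL_inv_subproof g : invmx g \in unitmx.
Proof. by rewrite unitmx_inv GL_unit. Qed.
Definition GL_inv g := MkGL (GL_inv_subproof g).
Fact GL_mul_subproof g h : g *m h \in unitmx.
Proof. by rewrite unitmx_mul !GL_unit. Qed.
Definition GL_mul g h := MkGL (GL_mul_subproof g h).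

Fact GL_mulA : associative GL_mul.
Proof. by move=> f g h; apply: val_inj; rewrite /= mulmxA. Qed.
Fact GL_mul1 : left_id GL_one GL_mul.
Proof. by move=> g; apply: val_inj; rewrite /= mul1mx. Qed.
Fact GL_mulr1 : right_id GL_one GL_mul.
Proof. by move=> g; apply: val_inj; rewrite /= mulmx1. Qed.
Fact GL_mulV : left_inverse GL_one GL_inv GL_mul.
Proof. by move=> g; apply: val_inj; rewrite /= mulVmx ?GL_unit. Qed.
Fact GL_mulrV : right_inverse GL_one GL_inv GL_mul.
Proof. by move=> g; apply: val_inj; rewrite /= mulmxV ?GL_unit. Qed.

HB.instance Definition _ := isGroup.Build (GL R n)
  GL_mulA GL_mul1 GL_mulr1 GL_mulV GL_mulrV.

End GLGroup.

(* The left cosets of a subgroup H of G; the group G acts on them by left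
   translation, C |-> [set (g * x)%g | x in C]. *)
Definition left_coset (G : groupType) (H : set G) (g : G) : set G :=
  [set (g * h)%g | h in H].

Definition left_cosets (G : groupType) (H : set G) : set (set G) :=
  range (left_coset H).

Section Action.
Variables (K : fieldType) (n : nat).
Local Notation A := (laurent K).
Local Notation V := 'cV[A]_n.
Implicit Types (g h : GL A n) (MN : set V * set V).

Definition rsd_act g MN : set V * set V :=
  ([set g *m x | x in MN.1], [set g *m x | x in MN.2]).

Definition rsd_stab MN : set (GL A n) := [set g | rsd_act g MN = MN].

Definition rsd_orbit MN : set (set V * set V) := range (rsd_act^~ MN).

Lemma rsd_act1 MN : rsd_act 1%g MN = MN.
Proof.
have act1 (M : set V) : [set (1%g : GL A n) *m x | x in M] = M.
  apply/seteqP; split=> [_ [x Mx <-]|x Mx]; first by rewrite mul1mx.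
  by exists x; rewrite ?mul1mx.
by case: MN => M N; congr pair; apply: act1.
Qed.

Lemma rsd_actM g h MN : rsd_act (g * h)%g MN = rsd_act g (rsd_act h MN).
Proof.
have actM (M : set V) : [set (g * h)%g *m x | x in M] =
    [set g *m x | x in [set h *m y | y in M]].
  apply/seteqP; split=> [_ [x Mx <-]|_ [_ [x Mx <-] <-]].
    by exists (h *m x); [exists x|rewrite mulmxA].
  by exists x; rewrite // mulmxA.
by case: MN => M N; congr pair; apply: actM.
Qed.

Lemma rsd_act_is_RSD g MN : is_RSD MN -> is_RSD (rsd_act g MN).
Proof.
have sub S (M : set V) : submodule_over S M ->
    submodule_over S [set g *m x | x in M].
  case=> M0 MD MZ; split.
  - by exists 0 => //; rewrite mulmx0.
  - by move=> _ _ [x Mx <-] [y My <-]; exists (x + y); rewrite ?mulmxDr //; apply: MD.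
  - by move=> a _ Sa [x Mx <-]; exists (a *: x); rewrite ?scalemxAr //; apply: MZ.
case=> -[kM kN] [S I] OM ON; split; [by split; apply: sub| |exact: sub|exact: sub].
split=> [v|].
  have [x [y [Mx Ny xy]]] := S (invmx g *m v).
  exists (g *m x), (g *m y); split; [by exists x|by exists y|].
  by rewrite -mulmxDr -xy mulKVmx ?GL_unit.
apply/seteqP; split=> [_ [[x Mx <-] [y Ny]]|_ ->] /=.
  move=> /(congr1 (mulmx (invmx g))); rewrite !mulKmx ?GL_unit // => yx.
  have : (MN.1 `&` MN.2) x by split=> //; rewrite -yx.
  by rewrite I => ->; rewrite mulmx0.
by split; exists 0; rewrite ?mulmx0 //; [case: OM|case: ON].
Qed.

End Action.

Section BlockDiagonal.
Variables (K : fieldType) (k l r : nat).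
Local Notation A := (laurent K).

(* diag(a, b, c), where GL_r(k) is a subgroup of GL_r(A) *)
Definition block_diag_mx (a : 'M[A]_k) (b : 'M[A]_l) (c : 'M[K]_r) :
    'M[A]_(k + l + r) :=
  block_mx (block_mx a 0 0 b) 0 0 (map_mx (in_alg A) c).

(* GL_k(A) x GL_l(A) x GL_r(k), as a subgroup of GL_(k+l+r)(A) *)
Definition block_diag_GL : set (GL A (k + l + r)) :=
  [set g | exists (a : GL A k) (b : GL A l) (c : GL K r),
             GLmx g = block_diag_mx a b c].

End BlockDiagonal.

Arguments block_diag_GL : clear implicits.

(* Main.v *)
Require Import Defs.
From HB Require Import structures.
From mathcomp Require Import all_boot all_order all_algebra.
From mathcomp Require Import zify.
From mathcomp Require Import boolp classical_sets functions fsbigop.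

Set Implicit Arguments.
Unset Strict Implicit.
Unset Printing Implicit Defensive.

Import Order.TTheory GRing.Theory.
Local Open Scope classical_set_scope.
Local Open Scope ring_scope.

(** A decomposition [(M, N)] and the projection [p] onto [M] along [N] determine
    each other: [M] and [N] are the eigenspaces of [p] for the eigenvalues 1
    and 0. Hence an invertible matrix stabilizes [(M, N)] exactly when it
    commutes with [p], that is, when it is an automorphism of the RB-module
    ([rsd_stab_commute]).

    An isomorphism of RB-modules onto [A_0^k + A_1^l + A_r^r] is, after writing
    the latter as column vectors, the product by some [h] in [GL_n(A)], and the
    translate [h (M, N)] then has as projection the operator [std_op] acting on
    the coordinates by 0, by the identity or by the projection [P] onto [k[[t]]].
    A matrix commutes with [std_op] if and only if each of its entries is a
    morphism between two of the modules [A_0], [A_1], [A_r]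
    ([std_op_commute]). There is no nonzero morphism between two different
    ones, every element of [A] is an endomorphism of [A_0] and of [A_1], and
    the endomorphisms of [A_r] are the constants. So the stabilizer of
    [h (M, N)] is the block diagonal group ([rsd_normal_form]).

    The stabilizer of [(M, N)] is the conjugate of that group by [h], which
    gives the group isomorphism. As [(M, N)] and [h (M, N)] have the same orbit,
    the description of the orbit is the orbit-stabilizer bijection for
    [h (M, N)] ([rsd_orbit_stabilizer]). *)

(** * Morphisms to and from the module of the regular part *)

Section RegularPartMorphisms.
Variable K : fieldType.
Local Notation A := (laurent K).
Implicit Types a x : A.

(** The series [t^-1], on which the identity and [regpart] differ; the
    constant 1 separates [regpart] from 0 in the same way. *)
Fact laurent_tinv_subproof :
  exists n, vanish_below n (fun i : int => (i == -1)%:R : K).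
Proof. by exists (-1) => i i1; rewrite (_ : (i == -1) = false) //; lia. Qed.
Definition laurent_tinv : A := Laurent laurent_tinv_subproof.

Lemma coef_mul_tinv x i : (x * laurent_tinv) i = x (i + 1).
Proof.
rewrite lcoefM -(fsbig_widen [set i + 1]) //; last first.
  move=> j [_ /= /eqP ji]; rewrite (_ : (i - j == -1) = false) ?mulr0 //.
  lia.
by rewrite fsbig_set1 /= (_ : (i - (i + 1) == -1) = true) ?mulr1 //; lia.
Qed.

Lemma laurent_tinv_neq0 : laurent_tinv != 0.
Proof.
apply/eqP => /(congr1 (fun f : A => f (-1))) /eqP.
by rewrite lcoef0 /= oner_eq0.
Qed.

Lemma regpart1 : regpart (1 : A) = 1.
Proof. by rewrite regpart_id // -[1]scale1r; apply: power_series_const. Qed.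

Lemma regpart_tinv : regpart laurent_tinv = 0.
Proof. by apply: regpart0 => i i0 /=; rewrite (_ : (i == -1) = false) //; lia. Qed.

(** No nonzero morphism from [A_0] to [A_r]: its image would be all of [A],
    hence contain 1, which [regpart] does not kill. *)
Lemma eq0_regpart_mul x : (forall a, regpart (x * a) = 0) -> x = 0.
Proof.
move=> Px; apply/eqP; apply/negPn/negP => x0.
by have /eqP := Px x^-1; rewrite divff // regpart1 oner_eq0.
Qed.

(** No nonzero morphism from [A_1] to [A_r]: its image would contain [t^-1],
    which [regpart] does not fix. *)
Lemma eq0_regpart_mul_id x : (forall a, regpart (x * a) = x * a) -> x = 0.
Proof.
move=> Px; apply/eqP; apply/negPn/negP => x0.
have /eqP := Px (x^-1 * laurent_tinv).
by rewrite mulVKf // regpart_tinv eq_sym (negPf laurent_tinv_neq0).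
Qed.

(** An endomorphism of [A_r] fixes the regular part of 1, so [x] lies in
    [k[[t]]]; and it sends [t^-1] into the kernel of [regpart], so
    [x * t^-1] has no coefficient in degree 0 or more, that is, [x] has none in
    positive degree. *)
Lemma regpart_endo_const x :
  (forall a, regpart (x * a) = x * regpart a) -> x = (x 0)%:A.
Proof.
move=> Px; apply: laurentP => i; rewrite lcoefZ lcoef1.
have [i0|i0|->] := ltgtP i 0; last by rewrite mulr1.
- have := Px 1; rewrite mulr0 regpart1 mulr1 => <-.
  by rewrite lcoef_regpart ifF //; lia.
- have := congr1 (fun f : A => f (i - 1)) (Px laurent_tinv).
  by rewrite regpart_tinv !mulr0 lcoef_regpart coef_mul_tinv subrK lcoef0 ifT //; lia.
Qed.

End RegularPartMorphisms.

(** * Stabilizers and orbits of decompositions *)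

Section Stabilizer.
Variables (K : fieldType) (n : nat).
Local Notation A := (laurent K).
Local Notation V := 'cV[A]_n.
Implicit Types (g h : GL A n) (MN : set V * set V).

Lemma GL_mulK g (v : V) : (g^-1)%g *m (g *m v) = v.
Proof. exact: mulKmx (Defs.GL_unit g) v. Qed.

Lemma GL_mulVK g (v : V) : g *m ((g^-1)%g *m v) = v.
Proof. exact: mulKVmx (Defs.GL_unit g) v. Qed.

Lemma projection_id MN : is_RSD MN ->
  forall v, MN.1 v <-> projection MN.1 MN.2 v = v.
Proof.
move=> RSD v; split=> [Mv|<-]; last by case: (projectionP RSD v).
by apply: projection_unique => //; rewrite subrr; case: RSD => -[] _ [].
Qed.

Lemma projection_eq0 MN : is_RSD MN ->
  forall v, MN.2 v <-> projection MN.1 MN.2 v = 0.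
Proof.
move=> RSD v; split=> [Nv|pv].
  by apply: projection_unique; rewrite ?subr0 //; case: RSD => -[] [].
by have [_] := projectionP RSD v; rewrite pv subr0.
Qed.

Lemma projection_act g MN (RSD : is_RSD MN) v :
  projection (rsd_act g MN).1 (rsd_act g MN).2 (g *m v) =
  g *m projection MN.1 MN.2 v.
Proof.
have [Mv Nv] := projectionP RSD v.
apply: (projection_unique (rsd_act_is_RSD g RSD)) => /=.
  by exists (projection MN.1 MN.2 v).
by exists (v - projection MN.1 MN.2 v); rewrite ?mulmxBr.
Qed.

(** The left-to-right direction is naturality of the projection. For the
    converse, the two summands are eigenspaces of the projection, and
    a matrix commuting with it, as well as its inverse, preserves these. *)
Lemma rsd_stab_commute MN : is_RSD MN -> forall g,
  rsd_stab MN g <->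
  forall v, projection MN.1 MN.2 (g *m v) = g *m projection MN.1 MN.2 v.
Proof.
move=> RSD g; split=> [gMN v|gp].
  by rewrite -(projection_act g RSD) gMN.
have VpV v : projection MN.1 MN.2 ((g^-1)%g *m v) =
    (g^-1)%g *m projection MN.1 MN.2 v.
  by rewrite -{2}[v](GL_mulVK g) gp GL_mulK.
(* Treating both summands at once, as eigenspaces for the scalar [c]. *)
suff act_id (W : set V) (c : K) : (forall v, W v <->
      projection MN.1 MN.2 v = c%:A *: v) -> [set g *m v | v in W] = W.
  rewrite /rsd_stab /=; case: (MN) RSD gp VpV act_id => M N RSD _ _ act_id.
  congr pair; [apply: (act_id _ 1)|apply: (act_id _ 0)] => v.
  - by rewrite (projection_id RSD) !scale1r.
  - by rewrite (projection_eq0 RSD) !scale0r.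
move=> W_eigen; apply/seteqP; split=> [_ [v /W_eigen Wv <-]|v /W_eigen Wv].
  by apply/W_eigen; rewrite gp Wv scalemxAr.
exists ((g^-1)%g *m v); last exact: GL_mulVK.
by apply/W_eigen; rewrite VpV Wv scalemxAr.
Qed.

Lemma rsd_stab_conj h g MN :
  rsd_stab MN g <-> rsd_stab (rsd_act h MN) (h * g * h^-1)%g.
Proof.
rewrite /rsd_stab /= -rsd_actM mulgVK rsd_actM; split=> [->//|].
by move=> /(congr1 (rsd_act (h^-1)%g)); rewrite -!rsd_actM mulVg mul1g rsd_act1.
Qed.

Lemma rsd_orbit_act h MN : rsd_orbit (rsd_act h MN) = rsd_orbit MN.
Proof.
apply/seteqP; split=> _ [g _ <-].
  by exists (g * h)%g; rewrite ?rsd_actM.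
by exists (g * h^-1)%g => //=; rewrite -rsd_actM mulgVK.
Qed.

(** A coset [C] is sent to the translate of [MN] by any of its elements;
    the chosen representative [xget 1 C] differs from [g], when [C] is the
    coset of [g], by an element that fixes [MN]. *)
Lemma rsd_orbit_stabilizer MN :
  exists F : set (GL A n) -> set V * set V,
    set_bij (left_cosets (rsd_stab MN)) (rsd_orbit MN) F
    /\ forall g (C : set (GL A n)), left_cosets (rsd_stab MN) C ->
         F [set (g * x)%g | x in C] = rsd_act g (F C).
Proof.
pose H := rsd_stab MN.
have H1 : H 1%g by apply: rsd_act1.
have [F FE] : exists F, forall g, F (left_coset H g) = rsd_act g MN.
  exists (fun C => rsd_act (xget 1%g C) MN) => g.
  have [h Hh <-] : left_coset H g (xget 1%g (left_coset H g)).
    by apply: (xgetPex 1%g); exists g; exists 1%g; rewrite ?mulg1.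
  by rewrite rsd_actM Hh.
have transl g x : [set (g * y)%g | y in left_coset H x] = left_coset H (g * x)%g.
  apply/seteqP; split=> [_ [_ [h Hh <-] <-]|_ [h Hh <-]].
    by exists h; rewrite ?mulgA.
  by exists (x * h)%g; [exists h|rewrite mulgA].
exists F; split; last by move=> g _ [x _ <-]; rewrite transl !FE rsd_actM.
split=> [_ [g _ <-]|C D|_ [g _ <-]].
- by rewrite FE; exists g.
- rewrite !inE => -[x _ <-] [y _ <-]; rewrite !FE => xy.
  have sub u v : rsd_act u MN = rsd_act v MN ->
      left_coset H u `<=` left_coset H v.
    move=> uv _ [h Hh <-]; exists (v^-1 * u * h)%g; last by rewrite -mulgA mulVKg.
    by rewrite /H /rsd_stab /= !rsd_actM Hh uv -rsd_actM mulVg rsd_act1.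
  by apply/seteqP; split; apply: sub.
- by exists (left_coset H g); [exists g|rewrite FE].
Qed.

End Stabilizer.

(** * Automorphisms of the standard module *)

(** The matrix [lin1_mx] acts on row vectors, whence the transpositions. Over a
    field an injective endomorphism has an invertible matrix. *)
Lemma linear_cV_GL (F : fieldType) n (phi : {linear 'cV[F]_n -> 'cV[F]_n}) :
  injective phi -> exists h : GL F n, forall v, phi v = h *m v.
Proof.
move=> phi_inj; pose M := (lin1_mx (trmx \o phi \o trmx))^T.
have phiE v : phi v = M *m v.
  by apply: trmx_inj; rewrite trmx_mul trmxK mul_rV_lin1 /= trmxK.
suff uM : M \in unitmx by exists (MkGL uM).
rewrite -unitmx_tr -row_free_unit -kermx_eq0; apply/eqP/row_matrixP => i.
rewrite row0; apply: trmx_inj; apply: phi_inj.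
rewrite trmx0 linear0 phiE; apply: trmx_inj.
by rewrite trmx_mul trmxK -row_mul mulmx_ker row0 trmx0.
Qed.

Section StandardModule.
Variables (K : fieldType) (k l r : nat).
Local Notation A := (laurent K).
Local Notation V := 'cV[A]_(k + l + r).
Implicit Types (g : 'M[A]_(k + l + r)).

(** The operators of [A_0], [A_1] and [A_r], laid out along the coordinates
    of the direct sum. *)
Definition coord_op (i : 'I_(k + l + r)) : {additive A -> A} :=
  match fintype.split i with
  | inl j => match fintype.split j with inl _ => \0 | inr _ => idfun end
  | inr _ => @regpart K
  end.

Definition std_op (v : V) : V := \col_i coord_op i (v i 0).

Lemma coord_op_zero (i : 'I_k) : coord_op (lshift r (lshift l i)) = \0.
Proof. by rewrite /coord_op !(unsplitK (inl _)). Qed.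

Lemma coord_op_id (i : 'I_l) : coord_op (lshift r (rshift k i)) = idfun.
Proof. by rewrite /coord_op (unsplitK (inl _)) (unsplitK (inr _)). Qed.

Lemma coord_op_reg (i : 'I_r) : coord_op (rshift (k + l) i) = @regpart K.
Proof. by rewrite /coord_op (unsplitK (inr _)). Qed.

(** By additivity it suffices to compare both sides on the vectors [a e_j]. *)
Lemma std_op_commute g :
  (forall v, std_op (g *m v) = g *m std_op v) <->
  forall i j a, coord_op i (g i j * a) = g i j * coord_op j a.
Proof.
split=> [gp i j a|gp v]; last first.
  apply/colP => i; rewrite !mxE raddf_sum; apply: eq_bigr => j _.
  by rewrite gp mxE.
have := congr1 (fun v : V => v i 0) (gp (a *: delta_mx j 0)).
rewrite !mxE (bigD1 j) //= big1 => [|m mj]; last first.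
  by rewrite !mxE (negPf mj) mulr0 mulr0.
rewrite (bigD1 j) //= big1 => [|m mj]; last first.
  by rewrite !mxE (negPf mj) mulr0 raddf0 mulr0.
by rewrite !mxE !eqxx mulr1 !addr0.
Qed.

Lemma block_diag_mx_unit (a : 'M[A]_k) (b : 'M[A]_l) (c : 'M[K]_r) :
  (block_diag_mx a b c \in unitmx) =
  [&& a \in unitmx, b \in unitmx & c \in unitmx].
Proof.
rewrite !unitmxE !det_lblock !unitrM -andbA -!unitmxE.
by rewrite map_unitmx.
Qed.

(** The off-diagonal blocks vanish because there is no nonzero morphism between
    two different modules among [A_0], [A_1], [A_r]. For those that end at [A_0]
    or go from [A_0] to [A_1] this is seen on the element 1, and for those from
    [A_r] to [A_1] on [t^-1]. *)
Lemma std_op_commute_block g :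
  (forall v, std_op (g *m v) = g *m std_op v) <->
  exists (a : 'M[A]_k) (b : 'M[A]_l) (c : 'M[K]_r), g = block_diag_mx a b c.
Proof.
rewrite std_op_commute; split=> [gp|[a [b [c ->]]] i j x].
  exists (ulsubmx (ulsubmx g)), (drsubmx (ulsubmx g)).
  exists (\matrix_(i, j) g (rshift _ i) (rshift _ j) 0).
  rewrite -[LHS]submxK -[ulsubmx g in LHS]submxK /block_diag_mx.
  congr block_mx; [congr block_mx| | |]; apply/matrixP => i j; rewrite !mxE.
  - have := gp (lshift r (lshift l i)) (lshift r (rshift k j)) 1.
    by rewrite coord_op_zero coord_op_id mulr1.
  - have := gp (lshift r (rshift k i)) (lshift r (lshift l j)) 1.
    by rewrite coord_op_zero coord_op_id mulr1 /= mulr0.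
  - case: (split_ordP i) => {}i ->.
      have := gp (lshift r (lshift l i)) (rshift (k + l) j) 1.
      by rewrite coord_op_zero coord_op_reg /= regpart1 mulr1.
    have /eqP := gp (lshift r (rshift k i)) (rshift (k + l) j) (laurent_tinv K).
    rewrite coord_op_id coord_op_reg /= regpart_tinv mulr0 mulf_eq0.
    by rewrite (negPf (laurent_tinv_neq0 K)) orbF => /eqP.
  - case: (split_ordP j) => {}j ->.
      apply: eq0_regpart_mul => a.
      have := gp (rshift (k + l) i) (lshift r (lshift l j)) a.
      by rewrite coord_op_zero coord_op_reg /= mulr0.
    apply: eq0_regpart_mul_id => a.
    have := gp (rshift (k + l) i) (lshift r (rshift k j)) a.
    by rewrite coord_op_id coord_op_reg.
  - apply: regpart_endo_const => a.
    by have := gp (rshift (k + l) i) (rshift (k + l) j) a; rewrite !coord_op_reg.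
rewrite /block_diag_mx; case: (split_ordP i) => {}i ->; case: (split_ordP j) => {}j ->.
- rewrite block_mxEul; case: (split_ordP i) => {}i ->; case: (split_ordP j) => {}j ->;
  by rewrite ?(block_mxEul, block_mxEur, block_mxEdl, block_mxEdr)
    ?coord_op_zero ?coord_op_id /= ?mxE ?mul0r ?mulr0.
- by rewrite block_mxEur mxE !mul0r raddf0.
- by rewrite block_mxEdl mxE !mul0r raddf0.
- by rewrite block_mxEdr mxE !coord_op_reg /= !mulr_algl linearZ.
Qed.

(** The blocks of an invertible block diagonal matrix are invertible. For the
    last block this is invertibility over [k]: a constant matrix is invertible
    over [A] only if its determinant, an element of [k], is nonzero. *)
Lemma block_diag_GLP (g : GL A (k + l + r)) :
  block_diag_GL K k l r g <-> forall v, std_op (g *m v) = g *m std_op v.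
Proof.
rewrite std_op_commute_block; split=> [[a [b [c gE]]]|[a [b [c gE]]]].
  by exists a, b, c.
have := Defs.GL_unit g; rewrite gE block_diag_mx_unit => /and3P[ua ub uc].
by exists (MkGL ua), (MkGL ub), (MkGL uc).
Qed.

Fact block_diag_subproof (x : GL A k * GL A l * GL K r) :
  block_diag_mx x.1.1 x.1.2 x.2 \in unitmx.
Proof. by rewrite block_diag_mx_unit !Defs.GL_unit. Qed.
Definition block_diag x := MkGL (block_diag_subproof x).

Lemma block_diag_inj : injective block_diag.
Proof.
move=> [[a b] c] [[a' b'] c'] /(congr1 val) /eq_block_mx[/eq_block_mx[aa _ _ bb] _ _ cc].
congr (_, _, _); apply: val_inj => //.
exact: map_mx_inj cc.
Qed.

Lemma block_diagM : {morph block_diag : x y / (x * y)%g}.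
Proof.
move=> x y; apply: val_inj.
rewrite /= /block_diag_mx !mulmx_block map_mxM.
by rewrite !(mul0mx, mulmx0, addr0, add0r).
Qed.

Definition conj_block_diag (h : GL A (k + l + r)) x : GL A (k + l + r) :=
  (h^-1 * block_diag x * h)%g.

Fact conj_block_diagM h : {morph conj_block_diag h : x y / (x * y)%g}.
Proof. by move=> x y; rewrite /conj_block_diag block_diagM !mulgA mulgK. Qed.
HB.instance Definition _ h :=
  isMultiplicative.Build _ _ (conj_block_diag h) (conj_block_diagM h).

Definition std_module : rb_module K :=
  rb_sum (rb_sum (rb_pow (rb_zero K) k) (rb_pow (rb_id K) l))
         (rb_pow (rb_reg K) r).

(** Concatenating coordinates is the linear isomorphism that carries the
    operator of [std_module] to [std_op]. *)
Definition std_col (z : std_module) : V :=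
  col_mx (col_mx (\col_i z.1.1 i) (\col_i z.1.2 i)) (\col_i z.2 i).

Fact std_col_linear : linear std_col.
Proof.
move=> a x y; rewrite /std_col !scale_col_mx !add_col_mx.
by congr (col_mx (col_mx _ _) _); apply/colP => i; rewrite !mxE !ffunE.
Qed.
HB.instance Definition _ :=
  GRing.isLinear.Build A std_module V *:%R std_col std_col_linear.

Lemma std_col_inj : injective std_col.
Proof.
move=> [[x y] z] [[x' y'] z'] /eq_col_mx[/eq_col_mx[/colP xx /colP yy] /colP zz].
by congr (_, _, _); apply/ffunP => i; [have := xx i|have := yy i|have := zz i];
  rewrite !mxE.
Qed.

Lemma std_col_op z : std_col (rb_op z) = std_op (std_col z).
Proof.
apply/colP => i; rewrite [RHS]mxE /std_col.
case: (split_ordP i) => {}i ->; last by rewrite !col_mxEd !mxE ffunE coord_op_reg.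
rewrite !col_mxEu; case: (split_ordP i) => {}i ->.
  by rewrite !col_mxEu !mxE ffunE coord_op_zero.
by rewrite !col_mxEd !mxE ffunE coord_op_id.
Qed.

End StandardModule.

(** The matrix [h] is that of the given isomorphism. It conjugates the projection
    of [MN] into [std_op], which is therefore the projection of the translate
    by [h]. *)
Lemma rsd_normal_form (K : fieldType) k l r MN (MN_RSD : is_RSD MN) :
    rb_iso (rsd_module MN_RSD) (std_module K k l r) ->
  exists h : GL (laurent K) (k + l + r),
    rsd_stab (rsd_act h MN) = block_diag_GL K k l r.
Proof.
case=> f [f_bij fp].
have [|h hE] := @linear_cV_GL _ _ (@std_col K k l r \o f).
  exact: inj_comp (@std_col_inj K k l r) (bij_inj f_bij).
exists h.
have pE v : projection (rsd_act h MN).1 (rsd_act h MN).2 v = std_op v.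
  rewrite -[v](GL_mulVK h) projection_act // -!hE /=.
  by rewrite -std_col_op -fp.
apply/seteqP; split=> g.
  move/(rsd_stab_commute (rsd_act_is_RSD h MN_RSD)) => gp.
  by apply/block_diag_GLP => v; rewrite -!pE gp.
move/block_diag_GLP => gp.
by apply/(rsd_stab_commute (rsd_act_is_RSD h MN_RSD)) => v; rewrite !pE gp.
Qed.

Theorem theorem5p5 (K : fieldType) (k l r : nat)
    (MN : set 'cV[laurent K]_(k + l + r) * set 'cV[laurent K]_(k + l + r))
    (MN_RSD : is_RSD MN) :
    rb_iso (rsd_module MN_RSD)
      (rb_sum (rb_sum (rb_pow (rb_zero K) k) (rb_pow (rb_id K) l))
              (rb_pow (rb_reg K) r)) ->
  (exists f : {multiplicative
        (GL (laurent K) k * GL (laurent K) l * GL K r)%type ->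
        GL (laurent K) (k + l + r)},
     set_bij [set: GL (laurent K) k * GL (laurent K) l * GL K r]
             (rsd_stab MN) f)
  /\
  (exists F : set (GL (laurent K) (k + l + r)) ->
              set 'cV[laurent K]_(k + l + r) * set 'cV[laurent K]_(k + l + r),
     set_bij (left_cosets (block_diag_GL K k l r)) (rsd_orbit MN) F
     /\ forall (g : GL (laurent K) (k + l + r))
               (C : set (GL (laurent K) (k + l + r))),
          left_cosets (block_diag_GL K k l r) C ->
          F [set (g * x)%g | x in C] = rsd_act g (F C)).
Proof.
move=> /rsd_normal_form[h stab_h]; split; last first.
  by rewrite -stab_h -(rsd_orbit_act h); apply: rsd_orbit_stabilizer.
exists (@conj_block_diag K k l r h); split=> [x _|x y _ _|g].
- apply/(rsd_stab_conj h); rewrite stab_h /conj_block_diag !mulgA mulgV mul1g mulgK.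
  by exists x.1.1, x.1.2, x.2.
- by move=> /mulIg /mulgI /block_diag_inj.
- move/(rsd_stab_conj h); rewrite stab_h => -[a [b [c gE]]].
  exists (a, b, c) => //; rewrite /= /conj_block_diag.
  have -> : block_diag (a, b, c) = (h * g * h^-1)%g by apply: val_inj.
  by rewrite -!mulgA mulVg mulg1 mulKg.
Qed.
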